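(* Let $(\Omega,\mu)$ be a $\sigma$-finite measure space and $p \in [1,\infty)$. Let $f \in L^p(\Omega,\mu)$, let $(f_j)_{j \in J}$ be a net in $L^p(\Omega,\mu)$, and assume that the index set $J$ contains a co-final sequence $(j_n)_{n \in \mathbb{N}}$. Then the following assertions are equivalent: (i) The net $(f_j)_{j \in J}$ is unboundedly order convergent to $f$. (ii) There exist a representative $\hat f : \Omega \to \mathbb{R}$ of $f$ and a family $(\hat f_j)_{j \in J}$ of representatives $\hat f_j : \Omega \to \mathbb{R}$ of $f_j$ such that $\lim_j \hat f_j(\omega) = \hat f(\omega)$ for all $\omega \in \Omega$.
   Context: $L^p(\Omega,\mu)$ is the real Banach lattice of almost-everywhere equivalence classes of real-valued measurable $p$-integrable functions, with the almost-everywhere order; a representative of an element is a measurable function $\Omega \to \mathbb{R}$ in that equivalence class. A sequence $(j_n)_{n\in\mathbb{N}}$ in a directed set $J$ is co-final if for every $j \in J$ there exists $n \in \mathbb{N}$ with $j_n \succeq j$. Order convergence: a net $(x_j)_{j\in J}$ in a Banach lattice $E$ order converges to $x \in E$ if there exists a decreasing net $(y_h)_{h \in H}$ in $E_+$ (with possibly different index set $H$) with infimum $0$ such that for each $h \in H$ there exists $j_0 \in J$ with $|x_j - x| \le y_h$ for all $j \succeq j_0$. Unbounded order convergence: a net $(x_j)_{j \in J}$ in $E$ is unboundedly order convergent to $x \in E$ if for every $u \in E_+$ the net $(|x_j - x| \wedge u)_{j \in J}$ order converges to $0$. *)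

(* Defs.v *)
From HB Require Import structures.
From mathcomp Require Import all_boot all_order all_algebra.
From mathcomp Require Import all_classical all_reals all_analysis.
From mathcomp Require Import ess_sup_inf measurable_realfun.
Set Implicit Arguments.
Unset Strict Implicit.
Unset Printing Implicit Defensive.
Import Order.TTheory GRing.Theory Num.Theory.
Import numFieldNormedType.Exports.
Local Open Scope classical_set_scope.
Local Open Scope ring_scope.

Section directed.
Context {dJ : Order.disp_t}.

Definition directed_set (J : preorderType dJ) : Prop :=
  inhabited J /\
  forall i j : J, exists k : J, (i <= k)%O /\ (j <= k)%O.

Definition cofinal_sequence (J : preorderType dJ) (s : nat -> J) : Prop :=
  forall j : J, exists n : nat, (j <= s n)%O.

Definition net_filter (J : preorderType dJ) : set_system J :=
  filter_from setT (fun j0 : J => [set j | (j0 <= j)%O]).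

End directed.
Arguments net_filter {dJ} J.

(* [LspaceType mu p1] is turned into a vector lattice: the operations are those
   of [LfunType mu p1], applied to chosen representatives, and the order is
   the almost everywhere order. *)
Section Lspace_vector_lattice.
Context d (T : measurableType d) (R : realType).
Variables (mu : {measure set T -> \bar R}) (p : \bar R) (p1 : (1 <= p)%E).

Local Notation Lp := (LspaceType mu p1).
Local Notation Lf := (LfunType mu p1).

Lemma ae_eq_Lnorm (f g : T -> R) :
  measurable_fun setT f -> measurable_fun setT g -> f = g %[ae mu] ->
  'N[mu]_p[EFin \o f]%E = 'N[mu]_p[EFin \o g]%E.
Proof.
move=> mf mg fg.
have fg' : (abse \o (EFin \o f)) = (abse \o (EFin \o g)) %[ae mu].
  by apply: filterS fg => x /= /(_ I) fgx _; rewrite fgx.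
have mpow (r : R) (h : T -> R) : measurable_fun setT h ->
    measurable_fun setT (fun x => (`|(h x)%:E| `^ r)%E).
  move=> mh; apply: (measurableT_comp (measurable_poweR _)).
  by apply: measurableT_comp => //; exact/measurable_EFinP.
rewrite unlock; case: p p1 => [r r1|_|//].
  congr (_ `^ _)%E; apply: ge0_ae_eq_integral => //.
  - exact: mpow.
  - exact: mpow.
  - by move=> *; exact: poweR_ge0.
  - by move=> *; exact: poweR_ge0.
  - by apply: filterS fg' => x /(_ I) fgx _; exact: (congr1 (poweR^~ r) fgx).
case: ifPn => // _; apply: eq_ess_sup.
by apply: filterS fg' => x /= /(_ I).
Qed.

Lemma Lfun_measurableTypeR (h : Lf) :
  @measurable_fun _ _ T (measurableTypeR R) setT h.
Proof.
have mh : measurable_fun setT h by exact: measurable_funPT.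
exact: mh.
Qed.

Definition Lfun_class (h : Lf) : {mfun_ mu, T >-> measurableTypeR R} :=
  (\pi_({mfun_ mu, T >-> measurableTypeR R})
     (@mfun_Sub _ _ T (measurableTypeR R) h
       (mem_set (Lfun_measurableTypeR h))))%qT.

Lemma aeEqMfun_measurable (f : {mfun_ mu, T >-> measurableTypeR R}) :
  measurable_fun setT (f : T -> R).
Proof.
have mf : @measurable_fun _ _ T (measurableTypeR R) setT f.
  exact: measurable_funPT.
exact: mf.
Qed.

Lemma aeEqMfun_eq (f g : {mfun_ mu, T >-> measurableTypeR R}) :
  (f : T -> R) = g %[ae mu] -> f = g.
Proof.
move=> fg; rewrite -[f]reprK -[g]reprK.
by apply/eqP; rewrite eqmodE; exact/asboolP.
Qed.

Lemma Lfun_classE (h : Lf) : (Lfun_class h : T -> R) = h %[ae mu].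
Proof.
have /eqP := reprK (Lfun_class h).
by rewrite {2}/Lfun_class eqmodE => /asboolP.
Qed.

Lemma Lfun_class_finite (h : Lf) : finite_norm mu p (Lfun_class h).
Proof.
rewrite /finite_norm (ae_eq_Lnorm _ _ (Lfun_classE h)).
- exact: Lfunction_finite.
- exact: aeEqMfun_measurable.
- exact: measurable_funPT.
Qed.

HB.instance Definition _ (h : Lf) :=
  @isFinLebesgue.Build d T R mu p p1 (Lfun_class h) (Lfun_class_finite h).

Definition Lclass (h : Lf) : Lp := [the Lp of Lfun_class h].

Lemma Lspace_Lfun (f : Lp) : (f : T -> R) \in Lfun mu p.
Proof.
apply/andP; split; apply: mem_set => /=; last exact: Lebesgue_finite.
exact: aeEqMfun_measurable.
Qed.

Definition Lrep (f : Lp) : Lf := Lfun_Sub p1 (Lspace_Lfun f).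

Lemma LclassE (h : Lf) : (Lclass h : T -> R) = h %[ae mu].
Proof. exact: Lfun_classE. Qed.

Lemma Lspace_eq (f g : Lp) : (f : T -> R) = g %[ae mu] -> f = g.
Proof.
move=> /aeEqMfun_eq; case: f g => [f [[nf]]] [g [[ng]]] /= fg.
by case: g / fg ng => ng; rewrite (Prop_irrelevance nf ng).
Qed.

HB.instance Definition _ := gen_eqMixin Lp.
HB.instance Definition _ := gen_choiceMixin Lp.

Definition Lspace_add (f g : Lp) : Lp := Lclass (Lrep f + Lrep g).
Definition Lspace_opp (f : Lp) : Lp := Lclass (- Lrep f).
Definition Lspace_zero : Lp := Lclass 0.

Let addE (f g : Lp) : (Lspace_add f g : T -> R) = f \+ g %[ae mu].
Proof. exact: LclassE. Qed.

Let oppE (f : Lp) : (Lspace_opp f : T -> R) = \- f %[ae mu].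
Proof. exact: LclassE. Qed.

Let zeroE : (Lspace_zero : T -> R) = cst 0 %[ae mu].
Proof. exact: LclassE. Qed.

Let addA : associative Lspace_add.
Proof.
move=> f g h; apply: Lspace_eq.
apply: filter_app (addE f (Lspace_add g h)); apply: filter_app (addE g h).
apply: filter_app (addE (Lspace_add f g) h); apply: filter_app (addE f g).
by apply: aeW => x /(_ I) e1 /(_ I) e2 /(_ I) e3 /(_ I) e4 _;
  rewrite e4 e2 /= e1 e3 /= addrA.
Qed.

Let addC : commutative Lspace_add.
Proof. by move=> f g; rewrite /Lspace_add addrC. Qed.

Let add0 : left_id Lspace_zero Lspace_add.
Proof.
move=> f; apply: Lspace_eq.
apply: filter_app (addE Lspace_zero f); apply: filter_app zeroE.
by apply: aeW => x /(_ I) e1 /(_ I) e2 _; rewrite e2 /= e1 /= add0r.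
Qed.

Let addN : left_inverse Lspace_zero Lspace_opp Lspace_add.
Proof.
move=> f; apply: Lspace_eq.
apply: filter_app (addE (Lspace_opp f) f); apply: filter_app (oppE f).
apply: filter_app zeroE.
by apply: aeW => x /(_ I) e1 /(_ I) e2 /(_ I) e3 _;
  rewrite e3 /= e2 e1 /= addNr.
Qed.

HB.instance Definition _ := GRing.isZmodule.Build Lp addA addC add0 addN.

Lemma LspaceD (f g : Lp) : ((f + g : Lp) : T -> R) = f \+ g %[ae mu].
Proof. exact: addE. Qed.

Lemma LspaceN (f : Lp) : ((- f : Lp) : T -> R) = \- f %[ae mu].
Proof. exact: oppE. Qed.

Lemma Lspace0 : ((0 : Lp) : T -> R) = cst 0 %[ae mu].
Proof. exact: zeroE. Qed.

Definition Lspace_le (f g : Lp) : bool := `[< {ae mu, forall x, f x <= g x} >].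

Let le_refl : reflexive Lspace_le.
Proof. by move=> f; apply/asboolP; exact: aeW. Qed.

Let le_anti : antisymmetric Lspace_le.
Proof.
move=> f g /andP[/asboolP fg /asboolP gf]; apply: Lspace_eq.
apply: filter_app fg; apply: filter_app gf.
by apply: aeW => x gf fg _; apply/eqP; rewrite eq_le fg gf.
Qed.

Let le_trans : transitive Lspace_le.
Proof.
move=> g f h /asboolP fg /asboolP gh; apply/asboolP.
apply: filter_app fg; apply: filter_app gh.
by apply: aeW => x gh fg; exact: le_trans fg gh.
Qed.

HB.instance Definition _ :=
  Order.Le_isPOrder.Build ring_display Lp le_refl le_anti le_trans.

Lemma Lspace_leP (f g : Lp) : reflect {ae mu, forall x, f x <= g x} (f <= g).
Proof. exact: asboolP. Qed.

Lemma maxr_Lfun (f g : Lf) : (f \max g : T -> R) \in Lfun mu p.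
Proof.
have -> : (f \max g : T -> R) =
    2^-1 *: ((f : T -> R) + g + (fun x => `|f x - g x|)).
  by apply/funext => x; rewrite /= maxr_absE mulrC.
have fgL : (f : T -> R) - g \in Lfun mu p by rewrite rpredB ?LfunP.
rewrite rpredZ// rpredD// ?rpredD ?LfunP//.
move: fgL => /andP[/[!inE] /= mfg nfg].
apply/andP; split; apply: mem_set => /=; first exact: measurableT_comp.
by rewrite /finite_norm -Lnorm_abse in nfg.
Qed.

Lemma minr_Lfun (f g : Lf) : (f \min g : T -> R) \in Lfun mu p.
Proof.
have -> : (f \min g : T -> R) = (f : T -> R) + g - (f \max g).
  apply/funext => x.
  rewrite -[RHS]/(f x + g x - Num.max (f x) (g x)) -(addr_max_min (f x)).
  by rewrite addrAC subrr add0r.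
by rewrite rpredB ?rpredD ?maxr_Lfun ?LfunP.
Qed.

Definition Lspace_join (f g : Lp) : Lp :=
  Lclass (Lfun_Sub p1 (maxr_Lfun (Lrep f) (Lrep g))).

Definition Lspace_meet (f g : Lp) : Lp :=
  Lclass (Lfun_Sub p1 (minr_Lfun (Lrep f) (Lrep g))).

Let joinE (f g : Lp) : (Lspace_join f g : T -> R) = f \max g %[ae mu].
Proof. exact: LclassE. Qed.

Let meetE (f g : Lp) : (Lspace_meet f g : T -> R) = f \min g %[ae mu].
Proof. exact: LclassE. Qed.

Let meetP (f g h : Lp) : (f <= Lspace_meet g h) = (f <= g) && (f <= h).
Proof.
apply/Lspace_leP/andP => [fgh|[/Lspace_leP fg /Lspace_leP fh]].
  split; apply/Lspace_leP; apply: filter_app fgh;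
  apply: filter_app (meetE g h); apply: aeW => x /(_ I) -> /=;
  by rewrite le_min => /andP[].
apply: filter_app fg; apply: filter_app fh; apply: filter_app (meetE g h).
by apply: aeW => x /(_ I) -> fh fg /=; rewrite le_min fg fh.
Qed.

Let joinP (f g h : Lp) : (Lspace_join f g <= h) = (f <= h) && (g <= h).
Proof.
apply/Lspace_leP/andP => [fgh|[/Lspace_leP fh /Lspace_leP gh]].
  split; apply/Lspace_leP; apply: filter_app fgh;
  apply: filter_app (joinE f g); apply: aeW => x /(_ I) -> /=;
  by rewrite ge_max => /andP[].
apply: filter_app fh; apply: filter_app gh; apply: filter_app (joinE f g).
by apply: aeW => x /(_ I) -> gh fh /=; rewrite ge_max fh gh.
Qed.

HB.instance Definition _ :=
  Order.POrder_MeetJoin_isLattice.Build ring_display Lp meetP joinP.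

Lemma LspaceU (f g : Lp) : ((f `|` g)%O : T -> R) = f \max g %[ae mu].
Proof. exact: joinE. Qed.

Lemma LspaceI (f g : Lp) : ((f `&` g)%O : T -> R) = f \min g %[ae mu].
Proof. exact: meetE. Qed.

(* [f : LspaceType mu p1] coerces to a chosen member of the class [f]; hence
   belonging to that class means being almost everywhere equal to it. *)
Definition representative (f : Lp) (g : T -> R) : Prop :=
  measurable_fun setT g /\ g = f %[ae mu].

End Lspace_vector_lattice.

Section order_convergence.
Context {d} {T : measurableType d} {R : realType}.
Context {mu : {measure set T -> \bar R}} {p : \bar R} {p1 : (1 <= p)%E}.
Local Notation E := (LspaceType mu p1).

(* Order convergence is defined in the generality needed, for nets in L^p. A
   structure joining [Zmodule] and [Lattice], to quantify over all Banach
   lattices, cannot be declared on top of the existing [Num.RealDomain]. *)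
Definition Lspace_abs (x : E) : E := (x `|` (- x))%O.

Definition order_converges {dJ : Order.disp_t} (J : preorderType dJ)
    (x : J -> E) (l : E) : Prop :=
  exists (dH : Order.disp_t) (H : preorderType dH) (y : H -> E),
    [/\ directed_set H,
        forall h, 0 <= y h,
        forall h k, (h <= k)%O -> y k <= y h,
        infimums (range y) 0 &
        forall h, exists j0, forall j, (j0 <= j)%O ->
          Lspace_abs (x j - l) <= y h].

Definition uo_converges {dJ : Order.disp_t} (J : preorderType dJ)
    (x : J -> E) (l : E) : Prop :=
  forall u : E, 0 <= u ->
    order_converges (fun j => (Lspace_abs (x j - l) `&` u)%O) 0.

End order_convergence.

(* Main.v *)
(** In both directions the essential supremum of a family of measurable
functions is attained by a countable subfamily.

If [f_j] is uo-convergent to [f], test against the indicators of countably many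
sets [F_n] of finite measure that cover the space. A dominating net with infimum
[0] has a countable subfamily whose pointwise infimum is almost everywhere [0],
so for each [j] only countably many almost everywhere inequalities are needed:
replace [f_j] by [f] on the null set where one of them fails.

Conversely let [y_j] be the essential supremum of [min |f_i - f| u] over
[i >= j]. As it is attained by countably many [i >= j], the pointwise
convergence of the representatives makes [y_j] tend to [0] at every point; along
the co-final sequence this only involves countably many null sets, so the
infimum of the [y_j] in [L^p] is [0]. *)
Require Import Defs.
From mathcomp Require Import all_boot all_order all_algebra.
From mathcomp Require Import all_classical all_reals all_analysis.
From mathcomp Require Import measurable_realfun.
Import Order.TTheory GRing.Theory Num.Theory.
Import numFieldNormedType.Exports.
Local Open Scope classical_set_scope.
Local Open Scope ring_scope.

(** * Essential suprema attained by countable subfamilies *)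

Lemma sequence_through (K : countType) (I : Type) (i0 : I) (t : K -> I) :
  exists s : nat -> I, forall k, exists n, s n = t k.
Proof.
(* Numbers that code no element of [K] are sent to the default [i0]. *)
exists (fun n => if unpickle n is Some k then t k else i0) => k.
by exists (pickle k); rewrite pickleK.
Qed.

Section essential_supremum.
Set Implicit Arguments.
Unset Strict Implicit.
Context d (T : measurableType d) (R : realType).

Lemma ae_forall_countable (mu : {measure set T -> \bar R}) (K : countType)
    (P : K -> T -> Prop) :
  (forall k, {ae mu, forall x, P k x}) -> {ae mu, forall x, forall k, P k x}.
Proof.
move=> aeP.
have : {ae mu, forall x, forall n,
    if unpickle n is Some k then P k x else True}.
  apply: ae_foralln => n; case: unpickle => [k|]; first exact: aeP.
  by apply: aeW.
by apply: filterS => x Px k; have := Px (pickle k); rewrite pickleK.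
Qed.

(* [s] is chosen so that the union of the [A (s n)] has maximal measure
   in [F]. *)
Lemma ess_union_finite (mu : {measure set T -> \bar R}) (I : Type) (i0 : I)
    (A : I -> set T) (F : set T) :
  measurable F -> (mu F < +oo)%E -> (forall i, measurable (A i)) ->
  exists s : nat -> I, forall i, mu ((A i `\` \bigcup_n A (s n)) `&` F) = 0.
Proof.
move=> mF Foo mA.
pose U (s : nat -> I) := \bigcup_n A (s n) `&` F.
have mU s : measurable (U s).
  by apply: measurableI => //; exact: bigcupT_measurable.
pose S := [set mu (U s) | s in setT].
have [u Su usup] : {u : nat -> \bar R | forall i, S (u i) &
    u x @[x --> \oo] --> ereal_sup S}.
  by apply: ereal_sup_seq; apply/set0P; exists (mu (U (fun=> i0))), (fun=> i0).
have /choice[t tu] : forall m, exists s, mu (U s) = u m.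
  by move=> m; have [s _ <-] := Su m; exists s.
have [s st] := @sequence_through (nat * nat)%type I i0 (fun k => t k.1 k.2).
have subU m : U (t m) `<=` U s.
  move=> x [[n _ tx] Fx]; split=> //.
  by have [k sk] := st (m, n); exists k => //; rewrite sk.
have supU : (ereal_sup S <= mu (U s))%E.
  rewrite -(cvg_lim (@ereal_hausdorff _) usup); apply: lime_le.
    exact: cvgP usup.
  by apply: nearW => m; rewrite -tu le_measure ?inE.
exists s => i.
(* Prepending [i] to [s] adds exactly [D] to [U s]; since [mu (U s)] is maximal and finite, [D] is
   null. *)
pose s' n := if n is n'.+1 then s n' else i.
set D := (X in mu X).
have mD : measurable D.
  apply: measurableI => //; apply: measurableD => //.
  exact: bigcupT_measurable.
have Us' : U s' = D `|` U s.
  apply/seteqP; split=> x.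
    move=> [[[|n] _ /= Ax] Fx]; last by right; split=> //; exists n.
    have [Ux|nUx] := pselect (U s x); [by right|left].
    by split=> //; split=> // Ux; apply: nUx.
  move=> [[[Ax _] Fx]|[[n _ Ax] Fx]]; split=> //; first by exists 0.
  by exists n.+1.
have : (mu (U s') <= mu (U s))%E.
  by apply: le_trans supU; apply: ereal_sup_ubound; exists s'.
have Usoo : mu (U s) \is a fin_num.
  rewrite ge0_fin_numE//; apply: le_lt_trans Foo.
  by rewrite le_measure ?inE// => x [].
rewrite Us' measureU//; last first.
  by apply/seteqP; split=> // x [[[_ nU] _] [Ux _]].
rewrite -[leRHS]add0e leeD2rE// => D0.
by apply/eqP; rewrite eq_le D0 measure_ge0.
Qed.

(** The finite case applies to each piece of a sigma-finite cover, and the countably many sequences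
    so obtained merge into one. *)
Lemma ess_union (mu : {measure set T -> \bar R}) (I : Type) (i0 : I)
    (A : I -> set T) :
  sigma_finite setT mu ->
  (forall i, measurable (A i)) ->
  exists s : nat -> I,
    forall i, {ae mu, forall x, A i x -> exists n, A (s n) x}.
Proof.
move=> [F UF mF] mA.
have /choice[t t0] : forall m, exists s : nat -> I, forall i,
    mu ((A i `\` \bigcup_n A (s n)) `&` F m) = 0.
  move=> m; have [mFm Foo] := mF m.
  exact: ess_union_finite.
have [s st] := @sequence_through (nat * nat)%type I i0 (fun k => t k.1 k.2).
exists s => i.
have : {ae mu, forall x, forall m,
    ~ ((A i `\` \bigcup_n A (t m n)) `&` F m) x}.
  apply: ae_foralln => m; exists ((A i `\` \bigcup_n A (t m n)) `&` F m).
  split=> //; last by move=> x /contrapT.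
  apply: measurableI; last by have [] := mF m.
  by apply: measurableD => //; exact: bigcupT_measurable.
apply: filterS => x nx Ax.
have [m _ Fx] : (\bigcup_i F i) x by rewrite -UF.
apply: contrapT => nA; apply: (nx m); split=> //; split=> // -[n _ tx].
by have [k sk] := st (m, n); apply: nA; exists k; rewrite sk.
Qed.

Lemma measurable_sup_range (G : nat -> T -> R) (w : T -> R) :
  (forall n, measurable_fun setT (G n)) -> (forall n x, G n x <= w x) ->
  measurable_fun setT (fun x => sup (range (fun n => G n x))).
Proof.
move=> mG Gw.
have -> : (fun x => sup (range (fun n => G n x))) =
    (fun x => sups (fun n => G n x) 0).
  apply/funext => x; rewrite /sups /=; congr sup; apply/seteqP.
  by split=> _ [n _ <-]; exists n.
apply: (@measurable_fun_sups _ _ _ setT G 0%N) => // x _.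
by exists (w x) => _ [n _ <-].
Qed.

(** If [G i] exceeded the supremum at a point, a rational would lie strictly between them; so it
    suffices to apply [ess_union] to the superlevel sets of each rational. *)
Lemma ess_sup_seq (mu : {measure set T -> \bar R}) (I : Type) (i0 : I)
    (G : I -> T -> R) (w : T -> R) :
  sigma_finite setT mu ->
  (forall i, measurable_fun setT (G i)) -> (forall i x, G i x <= w x) ->
  exists s : nat -> I, forall i,
    {ae mu, forall x, G i x <= sup (range (fun n => G (s n) x))}.
Proof.
move=> sfmu mG Gw.
have /choice[t tP] : forall q : rat, exists s : nat -> I, forall i,
    {ae mu, forall x, ratr q < G i x -> exists n, ratr q < G (s n) x}.
  move=> q.
  apply: (@ess_union mu I i0 (fun i => [set x | ratr q < G i x])) => // i.
  rewrite -[X in measurable X]setTI.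
  have := mG i measurableT `]ratr q, +oo[%classic (measurable_itv _).
  by congr measurable; apply/seteqP; split=> x; rewrite /= in_itv/= andbT.
have [s st] := @sequence_through (rat * nat)%type I i0 (fun k => t k.1 k.2).
exists s => i.
have : {ae mu, forall x, forall q : rat,
    ratr q < G i x -> exists n, ratr q < G (t q n) x}.
  by apply: ae_forall_countable => q; exact: tP.
apply: filterS => x tx; rewrite leNgt; apply/negP => /rat_in_itvoo[q].
rewrite in_itv/= => /andP[supq /tx[n]]; apply/negP; rewrite -leNgt.
apply: le_trans (ltW supq).
have [k /= <-] := st (q, n).
apply: ub_le_sup; last by exists k.
by exists (w x) => _ [m _ <-].
Qed.

End essential_supremum.

(** * Membership in L^p and the lattice operations at a point *)

Section Lspace_pointwise.
Set Implicit Arguments.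
Unset Strict Implicit.
Context d (T : measurableType d) (R : realType).
Variable (mu : {measure set T -> \bar R}).

(** The norm is monotone in the absolute value. This is what places the countable suprema and infima
    formed below in L^p. *)
Lemma Lfun_le (p : R) (g h : T -> R) : 0 <= p -> measurable_fun setT g ->
  h \in Lfun mu p%:E -> (forall x, `|g x| <= `|h x|) -> g \in Lfun mu p%:E.
Proof.
move=> p0 mg /andP[/[!inE] /= mh nh] gh.
apply/andP; split; apply: mem_set => //=.
move: nh; rewrite /finite_norm /= unlock; apply: le_lt_trans.
have mpow (f : T -> R) : measurable_fun setT f ->
    measurable_fun setT (fun x => (`|(f x)%:E| `^ p)%E).
  move=> mf; apply: (measurableT_comp (measurable_poweR _)).
  by apply: measurableT_comp => //; exact/measurable_EFinP.
apply: gt0_ler_poweR; rewrite ?invr_ge0//.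
- by rewrite in_itv/= leey andbT integral_ge0// => *; exact: poweR_ge0.
- by rewrite in_itv/= leey andbT integral_ge0// => *; exact: poweR_ge0.
apply: ge0_le_integral => //.
- by move=> *; exact: poweR_ge0.
- exact: mpow.
- exact: mpow.
- move=> x _; apply: gt0_ler_poweR => //; rewrite ?in_itv/= ?leey ?andbT//.
  by rewrite lee_fin.
Qed.

Lemma indic_Lfun (p : R) (A : set T) : p != 0 -> measurable A ->
  (mu A < +oo)%E -> \1_A \in Lfun mu p%:E.
Proof.
move=> p0 mA Aoo; apply/andP; split; apply: mem_set => /=.
  exact: measurable_indic.
rewrite /finite_norm /= unlock poweR_lty//.
rewrite (eq_integral (fun x => (\1_A x)%:E)) ?integral_indic ?setIT//.
move=> x _ /=; rewrite indicE; case: (x \in A) => /=.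
  by rewrite normr1 powR1.
by rewrite normr0 powR0.
Qed.

Section class.
Set Implicit Arguments.
Unset Strict Implicit.
Variables (p : \bar R) (p1 : (1 <= p)%E).
Local Notation Lp := (LspaceType mu p1).

Lemma Lspace_of_Lfun (g : T -> R) : g \in Lfun mu p ->
  exists z : Lp, (z : T -> R) = g %[ae mu].
Proof. by move=> gL; exists (Lclass (Lfun_Sub p1 gL)); exact: LclassE. Qed.

Lemma Lspace_ge0P (f : Lp) : 0 <= f <-> {ae mu, forall x, 0 <= f x}.
Proof.
split=> [/Lspace_leP|] f0; last apply/Lspace_leP.
  apply: filter_app f0; apply: filter_app (Lspace0 mu p1).
  by apply: aeW => x /(_ I) ->.
apply: filter_app f0; apply: filter_app (Lspace0 mu p1).
by apply: aeW => x /(_ I) ->.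
Qed.

Lemma Lspace_le0P (f : Lp) : f <= 0 <-> {ae mu, forall x, f x <= 0}.
Proof.
split=> [/Lspace_leP|] f0; last apply/Lspace_leP.
  apply: filter_app f0; apply: filter_app (Lspace0 mu p1).
  by apply: aeW => x /(_ I) ->.
apply: filter_app f0; apply: filter_app (Lspace0 mu p1).
by apply: aeW => x /(_ I) ->.
Qed.

Lemma Lspace_absE (f : Lp) :
  (Lspace_abs f : T -> R) = (fun x => `|f x|) %[ae mu].
Proof.
apply: filter_app (LspaceU f (- f)); apply: filter_app (LspaceN f).
by apply: aeW => x /(_ I) Nf /(_ I) -> _ /=; rewrite Nf maxrN.
Qed.

Lemma Lspace_dist_meetE (f g u : Lp) :
  ((Lspace_abs (f - g) `&` u)%O : T -> R) =
  (fun x => Num.min `|f x - g x| (u x)) %[ae mu].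
Proof.
apply: filter_app (LspaceI (Lspace_abs (f - g)) u).
apply: filter_app (Lspace_absE (f - g)).
apply: filter_app (LspaceD f (- g)); apply: filter_app (LspaceN g).
by apply: aeW => x /(_ I) Ng /(_ I) fg /(_ I) afg /(_ I) -> _ /=;
  rewrite afg fg /= Ng.
Qed.

End class.

End Lspace_pointwise.

(** * From unbounded order convergence to pointwise convergence *)

Section convergence.
Set Implicit Arguments.
Unset Strict Implicit.
Context d (T : measurableType d) (R : realType).
Variables (mu : {measure set T -> \bar R}) (sfmu : sigma_finite setT mu).
Variables (p : R) (p1 : (1 <= p%:E)%E).
Variables (dJ : Order.disp_t) (J : preorderType dJ).
Local Notation Lp := (LspaceType mu p1).

Let p_gt0 : 0 < p.
Proof. by apply: lt_le_trans ltr01 _; rewrite -lee_fin. Qed.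

(** Countably many members of the dominating net suffice: the [v k] are the moduli of members along
    a sequence that attains the essential infimum. *)
Lemma order_converges0_ae (x : J -> Lp) : order_converges x 0 ->
  exists (v : nat -> T -> R) (j : nat -> J),
    {ae mu, forall w, forall e, 0 < e -> exists k, v k w < e} /\
    forall k i, (j k <= i)%O -> {ae mu, forall w, `|x i w| <= v k w}.
Proof.
move=> [dH [H [y [[[h0] _] y0 _ [_ infy] xy]]]].
have my h : measurable_fun setT (y h : T -> R) by exact: aeEqMfun_measurable.
(* The sign turns infima into suprema; the absolute value makes the bound by [0] hold everywhere,
   not just almost everywhere. *)
pose G h w := - `|y h w|.
have mG h : measurable_fun setT (G h).
  by apply: measurableT_comp => //; exact: measurableT_comp.
have G0 h w : G h w <= 0 by rewrite oppr_le0.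
have [s Gs] := @ess_sup_seq _ T R mu H h0 G (fun=> 0) sfmu mG G0.
pose g w := sup (range (fun n => G (s n) w)).
have g0 w : g w <= 0.
  by apply: ge_sup; [exists (G (s 0%N) w), 0%N|move=> _ [n _ <-]].
have gG n w : G (s n) w <= g w.
  by apply: ub_le_sup; [exists 0 => _ [m _ <-]|exists n].
have mg : measurable_fun setT g.
  by apply: (@measurable_sup_range _ _ _ _ (fun=> 0)) => n;
    [exact: mG|exact: G0].
(* [z] is the class of the pointwise infimum of the [|y (s n)|], which lies between [0] and
   [|y (s 0)|]. *)
have [z zg] : exists z : Lp, (z : T -> R) = (fun w => - g w) %[ae mu].
  apply: Lspace_of_Lfun.
  apply: (@Lfun_le _ _ _ mu p _ (y (s 0%N) : T -> R) (ltW p_gt0)).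
  - exact: measurableT_comp.
  - exact: Lspace_Lfun.
  - by move=> w; rewrite normrN ler0_norm// lerNl gG.
(* By the choice of [s], [z] is a lower bound of all the [y h], whose infimum is [0]. *)
have z0 : z <= 0.
  apply: infy => _ [h _ <-]; apply/Lspace_leP.
  have /Lspace_ge0P yh0 := y0 h.
  apply: filter_app yh0; apply: filter_app (Gs h); apply: filter_app zg.
  apply: aeW => w /(_ I) -> Gg yh0.
  by rewrite lerNl -[X in - X](ger0_norm yh0).
have /choice[j xj] : forall k, exists j, forall i, (j <= i)%O ->
    Lspace_abs (x i - 0) <= y (s k) by move=> k; exact: xy.
exists (fun k w => `|y (s k) w|), j; split.
  move/Lspace_le0P : z0 => z0.
  apply: filter_app z0; apply: filter_app zg.
  apply: aeW => w /(_ I) ->; rewrite oppr_le0 => gw e e0.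
  have [||_ [k _ <-] Ge] := @sup_gt _ (range (fun n => G (s n) w)) (- e).
  - by exists (G (s 0%N) w), 0%N.
  - by apply: lt_le_trans gw; rewrite oppr_lt0.
  - by exists k; rewrite -ltrN2.
move=> k i /xj; rewrite subr0 => /Lspace_leP xy'.
apply: filter_app xy'; apply: filter_app (Lspace_absE (x i)).
by apply: aeW => w /(_ I) -> /le_trans; apply; exact: ler_norm.
Qed.

Lemma net_filter_Filter : directed_set J -> Filter (net_filter J).
Proof.
move=> [[j0] dirJ]; apply: filter_from_filter; first by exists j0.
move=> i j _ _; have [k [ik jk]] := dirJ i j; exists k => // l kl.
by split; [exact: le_trans ik kl|exact: le_trans jk kl].
Qed.

Variables (directedJ : directed_set J).
Variables (f : Lp) (fJ : J -> Lp).

Lemma uo_converges_representatives : uo_converges fJ f ->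
  exists (fhat : T -> R) (fhatJ : J -> T -> R),
    [/\ representative f fhat,
        forall j : J, representative (fJ j) (fhatJ j) &
        forall w : T, fhatJ j w @[j --> net_filter J] --> fhat w].
Proof.
move=> uo; have [F UF mF] := sfmu.
pose dist n i w := Num.min `|fJ i w - f w| (\1_(F n) w).
have /choice[v vP] : forall n, exists v : (nat -> T -> R) * (nat -> J),
    {ae mu, forall w, forall e, 0 < e -> exists k, v.1 k w < e} /\
    forall k i, (v.2 k <= i)%O -> {ae mu, forall w, `|dist n i w| <= v.1 k w}.
  move=> n; have [mFn Foo] := mF n.
  have [u u1] := @Lspace_of_Lfun _ _ _ mu _ p1 _
    (indic_Lfun (lt0r_neq0 p_gt0) mFn Foo).
  have u0 : 0 <= u.
    by apply/Lspace_ge0P; apply: filter_app u1; apply: aeW => w /(_ I) ->.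
  have [y [j [y0 yj]]] := order_converges0_ae (uo u u0).
  exists (y, j); split => // k i /yj; apply: filter_app.
  apply: filter_app (Lspace_dist_meetE (fJ i) f u); apply: filter_app u1.
  by apply: aeW => w /(_ I) u1 /(_ I) ->; rewrite u1.
pose small w := forall n e, 0 < e -> exists k, (v n).1 k w < e.
have aesmall : {ae mu, forall w, small w}.
  by apply: ae_foralln => n; have [] := vP n.
(* [J] may be uncountable, so the exceptional null set depends on [i]; for fixed [i] only the
   countably many pairs [n], [k] matter. *)
have /choice[B BP] : forall i, exists B, [/\ measurable B, mu B = 0 &
    forall w, ~ B w -> small w /\
      forall n k, ((v n).2 k <= i)%O -> `|dist n i w| <= (v n).1 k w].
  move=> i.
  have : {ae mu, forall w, small w /\
      forall n k, ((v n).2 k <= i)%O -> `|dist n i w| <= (v n).1 k w}.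
    apply: filterI => //; apply: ae_foralln => n; apply: ae_foralln => k.
    have [vi|nvi] := boolP ((v n).2 k <= i)%O; last exact: aeW.
    by have [_ /(_ _ _ vi)] := vP n; apply: filterS.
  move=> [B [mB B0 subB]]; exists B; split=> // w nB.
  by apply: contrapT => nw; apply: nB; exact: subB.
pose fhatJ i w := if w \in B i then f w else fJ i w.
have mf : measurable_fun setT (f : T -> R) by exact: aeEqMfun_measurable.
exists f, fhatJ; split.
- by split=> //; exact: aeW.
- move=> i; have [mB B0 _] := BP i; split.
    apply: measurable_fun_ifT => //; last exact: aeEqMfun_measurable.
    apply: (@measurable_fun_bool _ _ _ _ true); rewrite setTI.
    rewrite (_ : _ @^-1` _ = B i)//; apply/seteqP.
    by split=> w /=; [exact: set_mem|exact: mem_set].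
  exists (B i); split=> // w /= nw; apply: contrapT => nB; apply: nw => _.
  by rewrite /fhatJ memNset.
move=> w; have FJ := net_filter_Filter directedJ.
apply/cvgrPdist_lt => e e0.
(* Where [small] fails, [w] lies in every [B i], so the modified net is constantly [f w]. *)
have [sw|nsw] := pselect (small w); last first.
  apply: nearW => i; rewrite /fhatJ mem_set ?subrr ?normr0//.
  by apply: contrapT => nB; have [_ _ /(_ _ nB)[/nsw]] := BP i.
have [n _ Fw] : (\bigcup_i F i) w by rewrite -UF.
(* As [w] is in [F n], the distance is truncated at 1; a truncated value below [Num.min e 1] is
   therefore the distance itself. *)
have [|k vk] := sw n (Num.min e 1); first by rewrite lt_min e0 ltr01.
exists ((v n).2 k) => // i /= vi; rewrite /fhatJ.
case: ifPn => [_|/negP nB]; first by rewrite subrr normr0.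
have [_ _ /(_ w)[|_ /(_ _ _ vi)]] := BP i; first by move=> Bw; apply/nB/mem_set.
move=> /le_lt_trans/(_ vk); rewrite /dist indicE mem_set//= => lt_dist.
have := le_lt_trans (ler_norm _) lt_dist.
rewrite gt_min lt_min [1 < Num.min _ _]lt_min ltxx andbF orbF => /andP[+ _].
by rewrite distrC.
Qed.

(** * From pointwise convergence to unbounded order convergence *)

Lemma representatives_uo_converges (fhat : T -> R) (fhatJ : J -> T -> R) :
  (exists s : nat -> J, cofinal_sequence s) ->
  representative f fhat -> (forall j : J, representative (fJ j) (fhatJ j)) ->
  (forall w : T, fhatJ j w @[j --> net_filter J] --> fhat w) ->
  uo_converges fJ f.
Proof.
move=> [s cofinals] [mfhat ffhat] repJ cvgf u /Lspace_ge0P u0.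
have FJ := net_filter_Filter directedJ.
have mu' : measurable_fun setT (u : T -> R) by exact: aeEqMfun_measurable.
pose G i w := Num.min `|fhatJ i w - fhat w| `|u w|.
have mG i : measurable_fun setT (G i).
  apply: measurable_minr; apply: measurableT_comp => //.
  by apply: measurable_funB => //; have [] := repJ i.
have G_ge0 i w : 0 <= G i w by rewrite le_min !normr_ge0.
have Gu i w : G i w <= `|u w| by rewrite ge_min lexx orbT.
have /choice[t tP] : forall j, exists t : nat -> J,
    (forall n, (j <= t n)%O) /\ forall i, (j <= i)%O ->
      {ae mu, forall w, G i w <= sup (range (fun n => G (t n) w))}.
  move=> j.
  (* Working over the subtype of indices above [j] keeps the whole sequence [t j] above [j]. *)
  have [r rP] := @ess_sup_seq _ T R mu {i : J | (j <= i)%O}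
    (exist _ j (lexx j)) (fun i => G (sval i)) (fun w => `|u w|) sfmu
    (fun i => mG (sval i)) (fun i => Gu (sval i)).
  exists (fun n => sval (r n)); split=> [n|i ji]; first by case: (r n).
  exact: (rP (exist _ i ji)).
pose g j w := sup (range (fun n => G (t j n) w)).
have range0 j w : range (fun n => G (t j n) w) !=set0.
  by exists (G (t j 0%N) w), 0%N.
have gu j w : g j w <= `|u w| by apply: ge_sup => // _ [n _ <-].
have Gg j n w : G (t j n) w <= g j w.
  by apply: ub_le_sup; [exists `|u w| => _ [m _ <-]|exists n].
have g_ge0 j w : 0 <= g j w by exact: le_trans (Gg j 0%N w).
have /choice[z zg] : forall j, exists z : Lp, (z : T -> R) = g j %[ae mu].
  move=> j; apply: Lspace_of_Lfun.
  apply: (@Lfun_le _ _ _ mu p _ (u : T -> R) (ltW p_gt0)).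
  - by apply: (@measurable_sup_range _ _ _ _ (fun w => `|u w|)) => n;
      [exact: mG|exact: Gu].
  - exact: Lspace_Lfun.
  - by move=> w; rewrite ger0_norm.
(* The dominating net of tail suprema is indexed by [J] itself. *)
exists dJ, J, z; split => //.
- move=> j; apply/Lspace_ge0P; apply: filter_app (zg j).
  by apply: aeW => w /(_ I) ->.
- move=> j k jk; apply/Lspace_leP.
  (* Each [t k n] is above [k], hence above [j], so it belongs to the tail whose essential supremum
     is [g j]. *)
  have aeG : {ae mu, forall w, forall n, G (t k n) w <= g j w}.
    apply: ae_foralln => n; have [_ tj] := tP j; apply: tj.
    by apply: le_trans jk _; have [] := tP k.
  apply: filter_app aeG; apply: filter_app (zg j); apply: filter_app (zg k).
  by apply: aeW => w /(_ I) -> /(_ I) -> Gj; apply: ge_sup => // _ [n _ <-].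
- split=> [_ [j _ <-]|x xz].
    apply/Lspace_ge0P; apply: filter_app (zg j).
    by apply: aeW => w /(_ I) ->.
  (* Restricting to the indices [s n] leaves a single null set to discard. *)
  have xg : {ae mu, forall w, forall n, x w <= g (s n) w}.
    apply: ae_foralln => n.
    have /Lspace_leP xzs : x <= z (s n) by apply: xz; exists (s n).
    apply: filter_app xzs; apply: filter_app (zg (s n)).
    by apply: aeW => w /(_ I) ->.
  apply/Lspace_le0P; apply: filter_app xg; apply: aeW => w xg.
  apply/ler_addgt0Pr => e e0; rewrite add0r.
  have /cvgrPdist_le/(_ _ e0)[j0 _ j0e] := cvgf w.
  (* All indices [t (s n) m] are above [s n], hence above [j0], so every term of the supremum
     [g (s n) w] is at most [e]. *)
  have [n j0s] := cofinals j0; apply: le_trans (xg n) _.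
  apply: ge_sup => // _ [m _ <-]; rewrite ge_min distrC j0e//=.
  by apply: le_trans j0s _; have [] := tP (s n).
- move=> j; exists j => i ji; rewrite subr0; apply/Lspace_leP.
  have [_ /(_ _ ji) Gij] := tP j; have [_ fJi] := repJ i.
  apply: filter_app Gij; apply: filter_app u0; apply: filter_app (zg j).
  apply: filter_app ffhat; apply: filter_app fJi.
  apply: filter_app (Lspace_dist_meetE (fJ i) f u).
  apply: filter_app (Lspace_absE (Lspace_abs (fJ i - f) `&` u)%O).
  apply: aeW => w /(_ I) -> /(_ I) -> /(_ I) fJi /(_ I) ff /(_ I) -> u0.
  apply: le_trans; rewrite /G fJi ff (ger0_norm u0) ger0_norm ?lexx//.
  by rewrite le_min normr_ge0.
Qed.

End convergence.

Theorem theorem5p1 (d : measure_display) (T : measurableType d) (R : realType)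
    (mu : {sigma_finite_measure set T -> \bar R})
    (p : R) (p1 : (1 <= p%:E)%E)
    (dJ : Order.disp_t) (J : preorderType dJ)
    (directedJ : directed_set J)
    (cofinalJ : exists s : nat -> J, cofinal_sequence s)
    (f : LspaceType mu p1) (fJ : J -> LspaceType mu p1) :
  uo_converges fJ f <->
  exists (fhat : T -> R) (fhatJ : J -> T -> R),
    [/\ representative f fhat,
        forall j : J, representative (fJ j) (fhatJ j) &
        forall w : T, fhatJ j w @[j --> net_filter J] --> fhat w].
Proof.
have sfmu : sigma_finite setT mu by exact: sigma_finiteT.
split; first exact: uo_converges_representatives.
move=> [fhat [fhatJ [ffhat repJ cvgf]]].
exact: representatives_uo_converges cvgf.
Qed.
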